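(* (Spinless case.) Let $1\le M\le N$ be integers and let $G$ be the $M\times N$ grid graph (the interaction graph of the spinless $M\times N$ Fermi–Hubbard model). Then $d_{\mathrm{swap}}(G)=M-1$, and moreover there exists a swap network for $G$ with swap depth $M-1$ whose number of interaction layers equals the minimum number of interaction layers over all swap networks for $G$. (Spin case.) Let $2\le M\le N$ be integers and let $G'$ be the $2\times M\times N$ grid graph (the interaction graph of the $M\times N$ Fermi–Hubbard model with spin). Then $d_{\mathrm{swap}}(G')=2M-1$, and there exists a swap network for $G'$ with swap depth $2M-1$ and six interaction layers.
   Context: Grid graphs: the $M\times N$ grid graph has vertex set $\{(m,n): 0\le m<M,\ 0\le n<N\}$ with edges joining $(m,n),(m+1,n)$ and $(m,n),(m,n+1)$ whenever both endpoints exist; more generally the $M_1\times\cdots\times M_k$ grid graph is the Cartesian product of paths with $M_1,\ldots,M_k$ vertices (vertices are integer tuples with $0\le x_i<M_i$, adjacent iff they differ by $1$ in exactly one coordinate). Linear-connectivity swap network model: for a graph $G=(V,E)$ with $|V|=n$, qubits occupy positions $0,\ldots,n-1$ on a line; a configuration is a bijection $\pi:V\to\{0,\ldots,n-1\}$; a swap layer is a set of pairwise disjoint pairs of adjacent positions $\{i,i+1\}$, and applying it exchanges the vertices at the two positions of each pair. A swap network for $G$ consists of an initial configuration $\pi_0$ (chosen freely), swap layers $L_1,\ldots,L_d$ producing configurations $\pi_0,\ldots,\pi_d$, and a sequence of interaction layers, each attached to some configuration $\pi_t$ (several may be attached to the same configuration); an interaction layer at $\pi_t$ is a set of pairwise disjoint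 edges $\{v,w\}\in E$ with $|\pi_t(v)-\pi_t(w)|=1$. Every edge of $G$ must belong to some interaction layer. The swap depth is $d$; the number of interaction layers is the interaction depth. $d_{\mathrm{swap}}(G)$ is the minimum swap depth over all swap networks for $G$. *)

(* Defs.v *)
From mathcomp Require Import all_boot.
Set Implicit Arguments. Unset Strict Implicit. Unset Printing Implicit Defensive.

Definition config_ok (V : finType) (p : V -> nat) : Prop :=
  injective p /\ (forall v, p v < #|V|) /\
  (forall i, i < #|V| -> exists v, p v = i).

(* A swap layer is given by the set L of left positions i of the swapped pairs
   {i, i+1}; the pairs must lie in {0..n-1} and be pairwise disjoint. *)
Definition swap_layer_ok (n : nat) (L : seq nat) : Prop :=
  forall i, i \in L -> i.+1 < n /\ i.+1 \notin L.

Definition apply_swap (V : Type) (L : seq nat) (p : V -> nat) : V -> nat :=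
  fun v => let q := p v in
    if q \in L then q.+1
    else if (0 < q) && (q.-1 \in L) then q.-1 else q.

Definition config_at (V : Type) (p0 : V -> nat) (Ls : seq (seq nat)) (t : nat)
  : V -> nat :=
  foldl (fun p L => apply_swap L p) p0 (take t Ls).

Definition interaction_layer_ok (V : finType) (adj : rel V) (p : V -> nat)
  (I : seq (V * V)) : Prop :=
  (forall e, e \in I -> adj e.1 e.2 /\ ((p e.1).+1 = p e.2 \/ (p e.2).+1 = p e.1))
  /\ (forall e f, e \in I -> f \in I ->
        e = f \/ (e.1 <> f.1 /\ e.1 <> f.2 /\ e.2 <> f.1 /\ e.2 <> f.2)).

(* A swap network: initial configuration, swap layers L_1..L_d, and interaction
   layers, each attached to a configuration index t in {0..d}. *)
Record swap_net (V : finType) := SwapNet {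
  sn_init  : V -> nat;
  sn_swaps : seq (seq nat);
  sn_inter : seq (nat * seq (V * V)) }.

Definition swap_depth (V : finType) (S : swap_net V) : nat := size (sn_swaps S).
Definition interaction_depth (V : finType) (S : swap_net V) : nat := size (sn_inter S).

Definition is_swap_network (V : finType) (adj : rel V) (S : swap_net V) : Prop :=
  config_ok (sn_init S) /\
  (forall L, L \in sn_swaps S -> swap_layer_ok #|V| L) /\
  (forall tI, tI \in sn_inter S ->
     tI.1 <= size (sn_swaps S) /\
     interaction_layer_ok adj (config_at (sn_init S) (sn_swaps S) tI.1) tI.2) /\
  (forall v w, adj v w ->
     exists tI, tI \in sn_inter S /\ ((v, w) \in tI.2 \/ (w, v) \in tI.2)).

Definition dswap_eq (V : finType) (adj : rel V) (d : nat) : Prop :=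
  (exists S, is_swap_network adj S /\ swap_depth S = d) /\
  (forall S, is_swap_network adj S -> d <= swap_depth S).

Definition near (a b : nat) : bool := (a.+1 == b) || (b.+1 == a).

Definition grid2 (M N : nat) : rel ('I_M * 'I_N) :=
  fun x y =>
    ((x.1 == y.1) && near x.2 y.2) || (near x.1 y.1 && (x.2 == y.2)).

Definition grid3 (M N : nat) : rel ('I_2 * 'I_M * 'I_N) :=
  fun x y =>
    [|| near x.1.1 y.1.1 && (x.1.2 == y.1.2) && (x.2 == y.2),
        (x.1.1 == y.1.1) && near x.1.2 y.1.2 && (x.2 == y.2)
      | (x.1.1 == y.1.1) && (x.1.2 == y.1.2) && near x.2 y.2].

Arguments grid2 M N : clear implicits.
Arguments grid3 M N : clear implicits.

(* Main.v *)
Require Import Defs.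
From mathcomp Require Import all_boot zify.
Set Implicit Arguments. Unset Strict Implicit. Unset Printing Implicit Defensive.

(** Lower bounds.  An edge realised at time [t] has stretch at most
    [2 |t - e| + 1] in the configuration of time [e]; taking [e] in the middle
    of a network of depth [d], every edge has stretch about [d + 1] there.  If
    all vertex sets of size [k] have at least [B] outer neighbours, some
    neighbour of the first [k] vertices lies at distance at least [B] from
    them, whence [B <= d + 1].  In the [M x N] grid, a set with fewer than [M]
    outer neighbours either avoids, or contains, a full row and a full column,
    and is then very small, or very large; the spin grid is treated by
    comparing its two slices.

    Upper bounds.  Colour the grid as a chessboard, list the black and the
    white vertices by columns, interleave the two lists, and let black vertices
    move right and white ones move left.  In [d] layers a black vertex meets
    [d + 2] consecutive white ones, and its neighbours all lie in such a window.
    All edges leaving black vertices in a given direction are realised at a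
    common time, so that each direction costs a single interaction layer.  *)

(** * Configurations and their evolution under swap layers *)

Lemma config_ok_of_inj (V : finType) (p : V -> nat) :
  injective p -> (forall v, p v < #|V|) -> config_ok p.
Proof.
move=> p_inj p_lt; split=> //; split=> // i i_lt.
pose f v : 'I_#|V| := Ordinal (p_lt v).
have f_inj : injective f by move=> v w /(congr1 val) /p_inj.
have [g _ gK] := inj_card_bij f_inj (eq_leq (card_ord _)).
by exists (g (Ordinal i_lt)); have /(congr1 val) := gK (Ordinal i_lt).
Qed.

Lemma apply_swap_dist (V : Type) L (p : V -> nat) v :
  apply_swap L p v <= (p v).+1 /\ p v <= (apply_swap L p v).+1.
Proof. by rewrite /apply_swap; case: ifP => _; last case: ifP; lia. Qed.

(** The pairs of a layer are disjoint, so the layer acts as an involution; this makes the swapped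
    configuration injective. *)
Lemma apply_swapK (V : Type) n L (p : V -> nat) :
  swap_layer_ok n L -> apply_swap L (apply_swap L p) =1 p.
Proof.
move=> L_ok v; rewrite /apply_swap.
case: (boolP (p v \in L)) => [Lq|notLq].
  by have [_ /negbTE->] := L_ok _ Lq; rewrite /= Lq.
case: (boolP ((0 < p v) && ((p v).-1 \in L))) => [/andP[q_gt0 Lq] | /negbTE E].
  by rewrite Lq prednK.
by rewrite (negbTE notLq) E.
Qed.

Lemma apply_swap_config_ok (V : finType) L (p : V -> nat) :
  swap_layer_ok #|V| L -> config_ok p -> config_ok (apply_swap L p).
Proof.
move=> L_ok [p_inj [p_lt _]]; apply: config_ok_of_inj => [v w E | v].
  apply: p_inj; rewrite -(apply_swapK p L_ok v) -(apply_swapK p L_ok w).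
  by rewrite /apply_swap -!/(apply_swap L p _) E.
rewrite /apply_swap; case: ifP => [/L_ok[]//|_].
by have := p_lt v; case: ifP; lia.
Qed.

Lemma config_at_rcons (V : Type) (p0 : V -> nat) Ls t :
  t < size Ls ->
  config_at p0 Ls t.+1 = apply_swap (nth [::] Ls t) (config_at p0 Ls t).
Proof. by move=> t_lt; rewrite /config_at (take_nth [::] t_lt) foldl_rcons. Qed.

Lemma config_at_ok (V : finType) (p0 : V -> nat) Ls t :
  config_ok p0 -> (forall L, L \in Ls -> swap_layer_ok #|V| L) ->
  config_ok (config_at p0 Ls t).
Proof.
move=> p0_ok Ls_ok; elim: t => [|t IHt]; first by rewrite /config_at take0.
case: (ltnP t (size Ls)) => [t_lt | le_t].
  rewrite (config_at_rcons _ t_lt); apply: apply_swap_config_ok => //.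
  by apply: Ls_ok; rewrite mem_nth.
by move: IHt; rewrite /config_at !take_oversize // (leq_trans le_t).
Qed.

Lemma config_at_dist (V : Type) (p0 : V -> nat) Ls s t v :
  config_at p0 Ls s v <= config_at p0 Ls (s + t) v + t /\
  config_at p0 Ls (s + t) v <= config_at p0 Ls s v + t.
Proof.
elim: t => [|t [IH1 IH2]]; first by rewrite !addn0.
rewrite (addnS s t); case: (ltnP (s + t) (size Ls)) => [lt_st | le_st].
  have := apply_swap_dist (nth [::] Ls (s + t)) (config_at p0 Ls (s + t)) v.
  rewrite -config_at_rcons // => -[]; lia.
have -> : config_at p0 Ls (s + t).+1 = config_at p0 Ls (s + t).
  by rewrite /config_at !take_oversize // (leq_trans le_st).
lia.
Qed.

(** * Brickwork networks *)

Section Brickwork.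

(* Black vertices move right and white ones move left.  The white vertex of
   rank [i] precedes the black vertex of rank [j] at time [t] exactly when
   [i + c < j + t], so [brick_pos] adds to the rank of a vertex the number of
   vertices of the other colour before it. *)
Variables (V : finType) (black : V -> bool) (rank : V -> nat).
Variables (nb nw c : nat).

Definition brick_pos (t : nat) (v : V) : nat :=
  if black v then rank v + minn nw (rank v + t - c)
  else rank v + minn nb (rank v + c + 1 - t).

(** The black vertex of rank [j] and the white one of rank [i = j + t - c] stand at positions
    [j + i] and [j + i + 1] at time [t]; the filter keeps the truncated subtraction exact. *)
Definition brick_layer (t : nat) : seq nat :=
  [seq j + (j + t - c) | j <- iota 0 nb & c <= j + t < nw + c].

Lemma mem_brick_layer t q :
  reflect (exists j i, [/\ j < nb, i < nw, i + c = j + t & q = j + i])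
          (q \in brick_layer t).
Proof.
apply: (iffP mapP) => [[j]|[j [i [j_lt i_lt E ->]]]].
  rewrite mem_filter mem_iota => /andP[j_rng j_lt] ->.
  by exists j, (j + t - c); split; lia.
by exists j; rewrite ?mem_filter ?mem_iota; lia.
Qed.

(** For fixed [t] the left positions [j + i] share a parity, so no two pairs overlap. *)
Lemma brick_layer_ok t : swap_layer_ok (nb + nw) (brick_layer t).
Proof.
move=> _ /mem_brick_layer[j [i [j_lt i_lt E ->]]]; split; first lia.
by apply/mem_brick_layer=> -[j' [i' []]]; lia.
Qed.

Hypothesis rank_inj :
  forall v w, black v = black w -> rank v = rank w -> v = w.
Hypothesis rank_lt : forall v, rank v < if black v then nb else nw.

Lemma brick_pos_step t v :
  apply_swap (brick_layer t) (brick_pos t) v = brick_pos t.+1 v.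
Proof.
rewrite /apply_swap /brick_pos; have := rank_lt v; case: (black v) => r_lt.
  case: mem_brick_layer => [[j [i []]]|notL]; first lia.
  (* The would-be white partner has a rank outside the range, where [brick_pos] is clipped and does
     not change. *)
  have out : rank v + t < c \/ nw + c <= rank v + t.
    case: (leqP c (rank v + t)) => h1; last by left.
    case: (ltnP (rank v + t) (nw + c)) => h2; last by right.
    by case: notL; exists (rank v), (rank v + t - c); split; lia.
  by case: ifP => [/andP[r_gt0 /mem_brick_layer[j [i []]]]|_]; lia.
case: mem_brick_layer => [[j [i []]]|notL]; first lia.
case: ifP => [/andP[r_gt0 /mem_brick_layer[j [i []]]]|/negP notL']; first lia.
case: (leqP t (rank v + c)) => h1; last lia.
case: (ltnP (rank v + c) (nb + t)) => h2; last lia.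
case: notL'; apply/andP; split; first lia.
by apply/mem_brick_layer; exists (rank v + c - t), (rank v); split; lia.
Qed.

Lemma brick_config_at d t : t <= d ->
  config_at (brick_pos 0) (mkseq brick_layer d) t =1 brick_pos t.
Proof.
elim: t => [|t IHt] t_le v; first by rewrite /config_at take0.
rewrite config_at_rcons ?size_mkseq // nth_mkseq // -brick_pos_step.
by rewrite /apply_swap IHt // ltnW.
Qed.

Lemma brick_pos_inj t : injective (brick_pos t).
Proof.
move=> v w; rewrite /brick_pos; have := rank_lt v; have := rank_lt w.
case Bv: (black v); case Bw: (black w) => w_lt v_lt E;
  by [apply: rank_inj; rewrite ?Bv ?Bw //; lia | lia].
Qed.

(** The white vertex comes right after the black one in the first case and right before it in the
    second: at time [t] a black vertex of rank [r] meets the white ranks [r + t - c] and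
    [r + t - c - 1]. *)
Lemma brick_pos_near t v w : black v -> ~~ black w ->
  rank w + c = rank v + t \/ rank w + c + 1 = rank v + t ->
  (brick_pos t v).+1 = brick_pos t w \/ (brick_pos t w).+1 = brick_pos t v.
Proof.
rewrite /brick_pos => Bv /negbTE Bw.
have := rank_lt v; have := rank_lt w; rewrite Bv Bw; lia.
Qed.

Definition rel_edges (r : rel V) : seq (V * V) :=
  [seq e <- enum {: V * V} | r e.1 e.2].

Lemma mem_rel_edges r v w : ((v, w) \in rel_edges r) = r v w.
Proof. by rewrite mem_filter mem_enum andbT. Qed.

Definition brick_net d (rs : seq (nat * rel V)) : swap_net V :=
  SwapNet (brick_pos 0) (mkseq brick_layer d)
          [seq (tr.1, rel_edges tr.2) | tr <- rs].

(** Disjointness compares ordered pairs, so [r] can list an edge in one direction only. *)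
Definition layer_at (adj : rel V) (t : nat) (r : rel V) : Prop :=
  (forall v w, r v w -> adj v w /\
     ((brick_pos t v).+1 = brick_pos t w \/ (brick_pos t w).+1 = brick_pos t v))
  /\ (forall v w v' w', r v w -> r v' w' ->
        (v, w) = (v', w') \/ (v <> v' /\ v <> w' /\ w <> v' /\ w <> w')).

Lemma brick_netP (adj : rel V) d rs : nb + nw = #|V| ->
  (forall n, n < size rs -> let tr := nth (0, fun _ _ => false) rs n in
     tr.1 <= d /\ layer_at adj tr.1 tr.2) ->
  (forall v w, adj v w -> exists n, n < size rs /\
     let r := (nth (0, fun _ _ => false) rs n).2 in r v w \/ r w v) ->
  is_swap_network adj (brick_net d rs).
Proof.
move=> card_V rs_ok cov; split; [|split; [|split]] => /=.
- apply: config_ok_of_inj; first exact: brick_pos_inj.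
  move=> v; rewrite /brick_pos -card_V; have := rank_lt v.
  by case: (black v); lia.
- move=> L /mapP[t _ ->]; rewrite -card_V; exact: brick_layer_ok.
- move=> tI /(nthP (0, [::]))[n]; rewrite size_map size_mkseq => n_lt <-.
  have [t_le [r_adj r_disj]] := rs_ok n n_lt.
  rewrite (nth_map (0, fun _ _ => false)) //=; split=> //; split.
    case=> v w; rewrite mem_rel_edges => /r_adj; rewrite !brick_config_at //.
  by move=> [v w] [v' w']; rewrite !mem_rel_edges => Ev Ew; exact: r_disj Ev Ew.
- move=> v w /cov[n [n_lt Hn]].
  exists (nth (0, [::]) [seq (tr.1, rel_edges tr.2) | tr <- rs] n).
  rewrite mem_nth ?size_map // (nth_map (0, fun _ _ => false)) //=.
  by rewrite !mem_rel_edges.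
Qed.

(** The predicate [b] separates first endpoints from second ones; it may differ from the colouring
    that drives the network. *)
Lemma matching_disjoint (b : pred V) (r : rel V) :
  (forall v w, r v w -> b v /\ ~~ b w) ->
  (forall v w w', r v w -> r v w' -> w = w') ->
  (forall v v' w, r v w -> r v' w -> v = v') ->
  forall v w v' w', r v w -> r v' w' ->
    (v, w) = (v', w') \/ (v <> v' /\ v <> w' /\ w <> v' /\ w <> w').
Proof.
move=> r_b r_fun r_inj v w v' w' R R'.
have [[Bv Bw] [Bv' Bw']] := (r_b _ _ R, r_b _ _ R').
case: (eqVneq v v') R' => [<- R' | /eqP v_v' R'].
  by left; rewrite (r_fun _ _ _ R R').
right; split=> //; split; first by move=> E; rewrite -E Bv in Bw'.
split; first by move=> E; rewrite E Bv' in Bw.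
by move=> E; apply: v_v'; apply: r_inj R _; rewrite E.
Qed.

Lemma bipartite_layer_at (adj : rel V) t (r : rel V) :
  (forall v w, r v w -> [/\ adj v w, black v, ~~ black w &
     rank w + c = rank v + t \/ rank w + c + 1 = rank v + t]) ->
  (forall v w w', r v w -> r v w' -> w = w') ->
  (forall v v' w, r v w -> r v' w -> v = v') ->
  layer_at adj t r.
Proof.
move=> r_ok r_fun r_inj; split=> [v w /r_ok[Avw Bv Bw E] | ].
  by split=> //; apply: brick_pos_near.
by apply: (@matching_disjoint black) r_fun r_inj => v w /r_ok[].
Qed.

End Brickwork.

(** * Lower bounds for swap networks *)

(** Edges at [v] meet pairwise, so they lie in distinct layers; [f] picks the first layer holding
    the edge to a neighbour. *)
Lemma degree_le_interaction_depth (V : finType) (adj : rel V) S v (s : seq V) :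
  is_swap_network adj S -> uniq s -> (forall w, w \in s -> adj v w) ->
  size s <= interaction_depth S.
Proof.
move=> [_ [_ [I_ok cov]]] s_uniq s_adj; rewrite /interaction_depth.
pose P w (tI : nat * seq (V * V)) := ((v, w) \in tI.2) || ((w, v) \in tI.2).
pose f w := find (P w) (sn_inter S).
have f_lt w : w \in s -> f w < size (sn_inter S).
  move=> /s_adj /cov[tI [tI_in Hw]]; rewrite -has_find; apply/hasP.
  by exists tI => //; apply/orP.
have f_inj : {in s &, injective f}.
  move=> w w' sw sw' E; pose tI := nth (0, [::]) (sn_inter S) (f w).
  have Pw : P w tI by apply: nth_find; rewrite has_find; exact: f_lt.
  have Pw' : P w' tI by rewrite /tI E; apply: nth_find; rewrite has_find; exact: f_lt.
  have [_ [_ disj]] := I_ok tI (mem_nth _ (f_lt w sw)).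
  case/orP: Pw => /disj Hw; case/orP: Pw' => /Hw /= [[]|]; by [congruence | tauto].
rewrite -(size_map f) -(size_iota 0 (size (sn_inter S))).
apply: uniq_leq_size; first by rewrite map_inj_in_uniq.
by move=> _ /mapP[w sw ->]; rewrite mem_iota f_lt.
Qed.

Definition vbd (V : finType) (adj : rel V) (A : {set V}) : {set V} :=
  [set w | (w \notin A) && [exists v in A, adj v w]].

Lemma vbdP (V : finType) (adj : rel V) (A : {set V}) w :
  reflect (w \notin A /\ exists2 v, v \in A & adj v w) (w \in vbd adj A).
Proof.
rewrite inE; apply: (iffP andP) => -[wA].
  by case/exists_inP=> v vA avw; split=> //; exists v.
by case=> v vA avw; split=> //; apply/exists_inP; exists v.
Qed.

Lemma card_prefix (V : finType) (p : V -> nat) k :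
  config_ok p -> k <= #|V| -> #|[set v | p v < k]| = k.
Proof.
move=> [p_inj [p_lt p_surj]] k_le; rewrite cardE -(size_map p) -[RHS](size_iota 0).
apply/perm_size/uniq_perm; rewrite ?iota_uniq ?map_inj_uniq ?enum_uniq //.
move=> i; rewrite mem_iota add0n; apply/mapP/idP => [[v]|i_lt].
  by rewrite mem_enum inE => v_lt ->.
have [v E] := p_surj i (leq_trans i_lt k_le).
by exists v; rewrite ?mem_enum ?inE E.
Qed.

(** Pigeonhole: only [B - 1] positions lie from [k] up to [k + B - 2]. *)
Lemma far_boundary_vertex (V : finType) (p : V -> nat) k B (D : {set V}) :
  injective p -> (forall v, v \in D -> k <= p v) -> 0 < B -> B <= #|D| ->
  exists2 v, v \in D & k + B <= (p v).+1.
Proof.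
move=> p_inj D_ge B_gt0 B_le; apply/exists_inP; apply: contraLR B_le => /exists_inPn far.
rewrite -ltnNge -(prednK B_gt0) ltnS cardE -(size_map p) -(size_iota k B.-1).
apply: uniq_leq_size; first by rewrite map_inj_uniq ?enum_uniq.
move=> _ /mapP[v + ->]; rewrite mem_enum => vD.
by rewrite mem_iota D_ge //=; have := far v vD; lia.
Qed.

(** * Edges stretched across a cut of the line *)

Section Cut.
Variables (V : finType) (adj : rel V) (S : swap_net V).
Hypothesis S_ok : is_swap_network adj S.
Let p := config_at (sn_init S) (sn_swaps S).

(** Here [w] is a far boundary vertex of the first [k] vertices at time [e], [v] a neighbour among
    them, and [t] a time at which their edge is realised. *)
Lemma config_at_prefix_stretch e k B : 0 < B -> k <= #|V| ->
  (forall A : {set V}, #|A| = k -> B <= #|vbd adj A|) ->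
  exists v w t, [/\ p e v < k, k + B <= (p e w).+1, t <= swap_depth S &
                    (p t v).+1 = p t w \/ (p t w).+1 = p t v].
Proof.
move=> B_gt0 k_le iso; have [init_ok [Ls_ok [I_ok cov]]] := S_ok.
have pe_ok : config_ok (p e) by apply: config_at_ok.
have := iso _ (card_prefix pe_ok k_le); set D := vbd _ _ => B_le.
have D_ge v : v \in D -> k <= p e v by case/vbdP; rewrite inE -leqNgt.
have [w wD w_far] := far_boundary_vertex (proj1 pe_ok) D_ge B_gt0 B_le.
have [_ [v]] := vbdP _ _ _ wD; rewrite inE => v_lt /cov[tI [tI_in H]].
have [t_le [I_adj _]] := I_ok _ tI_in.
exists v, w, tI.1; split=> //.
by case: H => /I_adj[_] /=; rewrite -/p; tauto.
Qed.

Lemma config_at_le s t v : p s v <= p t v + (s - t) + (t - s).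
Proof.
have dist := config_at_dist (sn_init S) (sn_swaps S); case: (leqP s t) => st.
  have := dist s (t - s) v; rewrite subnKC // -/p; lia.
have := dist t (s - t) v; rewrite subnKC ?(ltnW st) // -/p; lia.
Qed.

(* Every edge is realised within [uphalf d] layers of the middle configuration,
   where its stretch is therefore at most [2 * uphalf d + 1]. *)
Lemma isoperimetric_depth k B : 0 < B -> k <= #|V| ->
  (forall A : {set V}, #|A| = k -> B <= #|vbd adj A|) ->
  B <= 2 * uphalf (swap_depth S) + 1.
Proof.
move=> B_gt0 k_le iso; set d := swap_depth S.
have [v [w [t [v_lt w_far t_le pt]]]] := config_at_prefix_stretch d./2 B_gt0 k_le iso.
have := config_at_le d./2 t w; have := config_at_le t d./2 v.
rewrite -/d in t_le; lia.
Qed.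

Lemma prefix_stable e k : e < swap_depth S -> 0 < k ->
  k.-1 \notin nth [::] (sn_swaps S) e ->
  forall v, p e v < k -> p e.+1 v < k.
Proof.
move=> e_lt k_gt0 kL v v_lt; rewrite /p config_at_rcons // /apply_swap -/p.
case: ifP => [vL | _]; last by case: ifP; lia.
have : p e v != k.-1 by apply: contraNneq kL => <-.
lia.
Qed.

(* For odd depth, the prefix of a cut that the middle layer does not swap
   across is the same before and after that layer, and half a layer is gained
   on each side. *)
Lemma isoperimetric_depth2 k B : 0 < B -> 0 < k -> k < #|V| ->
  (forall A : {set V}, k <= #|A| <= k.+1 -> B <= #|vbd adj A|) ->
  B <= (swap_depth S).+1.
Proof.
move=> B_gt0 k_gt0 k_lt iso; set d := swap_depth S.
have isok : forall A : {set V}, #|A| = k -> B <= #|vbd adj A|.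
  by move=> A A_k; apply: iso; rewrite A_k; lia.
case: (boolP (odd d)) => d_odd; last first.
  have := isoperimetric_depth B_gt0 (ltnW k_lt) isok; rewrite -/d; lia.
set e := d./2; have e_lt : e < d by rewrite /e; lia.
(* Swapped pairs are disjoint, so the middle layer cannot cross both cuts [k] and [k.+1]. *)
have [k' [k'_rng k'L]] : exists k', k <= k' <= k.+1 /\
    k'.-1 \notin nth [::] (sn_swaps S) e.
  case: (boolP (k.-1 \in nth [::] (sn_swaps S) e)) => kL; last first.
    by exists k; split=> //; lia.
  have [_ [Ls_ok _]] := S_ok.
  have [_] := Ls_ok _ (mem_nth [::] e_lt) _ kL; rewrite prednK // => kL'.
  by exists k.+1; split=> //; lia.
have iso' : forall A : {set V}, #|A| = k' -> B <= #|vbd adj A|.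
  by move=> A A_k; apply: iso; rewrite A_k.
have k'_le : k' <= #|V| by lia.
have [v [w [t [v_lt w_far t_le pt]]]] := config_at_prefix_stretch e B_gt0 k'_le iso'.
have k'_gt0 : 0 < k' by lia.
have v_lt' := prefix_stable e_lt k'_gt0 k'L v_lt.
(* The stretch is measured at [e] if [t <= e] and at [e.+1] otherwise; in the latter case the middle
   layer may have brought [w] one place closer, which costs the extra unit in the bound. *)
have := config_at_le e t w; have := config_at_le t e v.
have := config_at_le e.+1 t w; have := config_at_le t e.+1 v.
have := config_at_le e e.+1 w.
rewrite -/d in t_le; rewrite /e in v_lt' w_far v_lt *; lia.
Qed.

End Cut.

(** * Vertex isoperimetry in grids *)

Definition odist n (a b : 'I_n) : nat := (a - b) + (b - a).

(** Walk from [a] towards [b] until the first exit from [P]. The strict decrease of the distance is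
    what [thick_columns] uses to leave the column nearest to the empty one. *)
Lemma line_exit n (P : pred 'I_n) (a b : 'I_n) : P a -> ~~ P b ->
  exists u u' : 'I_n, [/\ near u u', P u, ~~ P u' & odist u' b < odist a b].
Proof.
have [m] := ubnP (odist a b); elim: m a => // m IHm a a_lt Pa Pb.
have [a' near_a a'_lt] : exists2 a' : 'I_n, near a a' & odist a' b < odist a b.
  have a_b : (a : nat) != b by apply: contraNneq Pb => /val_inj <-.
  have [? ?] := (ltn_ord a, ltn_ord b).
  case: (ltnP a b) => ab.
    have h : a.+1 < n by lia.
    by exists (Ordinal h); rewrite /near /odist /=; lia.
  have h : a.-1 < n by lia.
  by exists (Ordinal h); rewrite /near /odist /=; lia.
case: (boolP (P a')) => Pa'; last by exists a, a'.
have [|u [u' [? ? ? ?]]] := IHm a' _ Pa' Pb; first lia.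
by exists u, u'; split=> //; lia.
Qed.

Lemma nearC a b : near a b = near b a.
Proof. by rewrite /near orbC. Qed.

Section Grid2.
Variables (M N : nat).
Implicit Types A : {set 'I_M * 'I_N}.
Local Notation bd := (vbd (grid2 M N)).

Lemma grid2_sym v w : grid2 M N v w = grid2 M N w v.
Proof. by rewrite /grid2 nearC [near v.1 _]nearC (eq_sym v.1) (eq_sym v.2). Qed.

Lemma row_exit A x y y' : (x, y) \in A -> (x, y') \notin A ->
  exists2 u, (x, u) \in bd A & odist u y' < odist y y'.
Proof.
move=> Ay Ay'; have [u [u' [nu Au Au' lt_u']]] :=
  @line_exit _ [pred z | (x, z) \in A] y y' Ay Ay'.
exists u' => //; apply/vbdP; split=> //; exists (x, u) => //.
by rewrite /grid2 /= eqxx nu.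
Qed.

Lemma col_exit A x x' y : (x, y) \in A -> (x', y) \notin A ->
  exists u, (u, y) \in bd A.
Proof.
move=> Ax Ax'; have [u [u' [nu Au Au' _]]] :=
  @line_exit _ [pred z | (z, y) \in A] x x' Ax Ax'.
exists u'; apply/vbdP; split=> //; exists (u, y) => //.
by rewrite /grid2 /= eqxx nu orbT.
Qed.

(* Each of the [#|T|] columns holding at least [m] points of [A] contains a
   boundary point; and from the one nearest to the empty column, at least [m]
   rows are left through boundary points lying in other columns. *)
Lemma thick_columns A x0 y0 m :
  (forall y, (x0, y) \notin A) -> (forall x, (x, y0) \notin A) -> 0 < m ->
  #|[set y | m <= #|[set x | (x, y) \in A]|]| <= #|bd A| - m.
Proof.
move=> x0_empty y0_empty m_gt0; set T := [set y | _].
have [->|[y1 y1T]] := set_0Vmem T; first by rewrite cards0.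
pose y2 := [arg min_(y < y1 in T) odist y y0].
have [y2T y2_min] : y2 \in T /\ forall y, y \in T -> odist y2 y0 <= odist y y0.
  by rewrite /y2; case: arg_minnP.
have T_le : #|T| <= #|bd A :&: [set v | v.2 \in T]|.
  apply: leq_trans (leq_imset_card snd _); apply/subset_leq_card/subsetP => y yT.
  have : 0 < #|[set x | (x, y) \in A]|.
    by apply: leq_trans m_gt0 _; move: yT; rewrite inE.
  case/card_gt0P => x; rewrite inE => xyA.
  have [u uB] := col_exit xyA (x0_empty y).
  by apply/imsetP; exists (u, y); rewrite // in_setI uB inE.
have m_le : m <= #|bd A :\: [set v | v.2 \in T]|.
  apply: leq_trans (leq_imset_card fst _).
  apply: (@leq_trans #|[set x | (x, y2) \in A]|); first by move: y2T; rewrite inE.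
  apply/subset_leq_card/subsetP => x; rewrite inE => xA.
  have [u uB u_lt] := row_exit xA (y0_empty x).
  apply/imsetP; exists (x, u) => //; rewrite in_setD uB andbT inE /=.
  by apply: contraL u_lt => /y2_min; rewrite -leqNgt.
have := cardsID [set v | v.2 \in T] (bd A); lia.
Qed.

(** The nonzero terms are among [b - 1, ..., 1], whose sum is triangular. *)
Lemma sum_staircase b n : 2 * (\sum_(m < n) (b - m.+1)) <= b * b.-1.
Proof.
elim: n b => [|n IHn] b; first by rewrite big_ord0 muln0.
case: b => [|b]; first by rewrite big1 // => i _; rewrite sub0n.
rewrite big_ord_recl /=; under eq_bigr => i _ do rewrite /bump /= add1n subSS.
have := IHn b; case: b => [|b] /=; nia.
Qed.

(** Layer-cake count: a column with [k] points is counted once for each [m < k]. *)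
Lemma card_columns A :
  #|A| = \sum_(m < M) #|[set y | m < #|[set x | (x, y) \in A]|]|.
Proof.
have -> : #|A| = \sum_y #|[set x | (x, y) \in A]|.
  rewrite -sum1_card (eq_bigr (fun=> 1)) //.
  rewrite (eq_bigr (fun y : 'I_N => \sum_(x | (x, y) \in A) 1)); last first.
    by move=> y _; rewrite -sum1_card; apply: eq_bigl => x; rewrite inE.
  rewrite (exchange_big_dep xpredT) //= pair_big_dep /=.
  by apply: eq_bigl => -[].
rewrite (eq_bigr (fun y => \sum_(m < M | m < #|[set x | (x, y) \in A]|) 1)).
  rewrite (exchange_big_dep xpredT) //=; apply: eq_bigr => m _.
  by rewrite -sum1_card; apply: eq_bigl => y; rewrite inE.
move=> y _; set k := #|_|; have k_le : k <= M by rewrite -[M in _ <= M]card_ord max_card.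
by rewrite (big_ord_narrow k_le) sum1_card card_ord.
Qed.

Lemma card_avoiding A x0 y0 :
  (forall y, (x0, y) \notin A) -> (forall x, (x, y0) \notin A) ->
  2 * #|A| <= #|bd A| * #|bd A|.-1.
Proof.
move=> x0_empty y0_empty; rewrite card_columns.
apply: leq_trans (sum_staircase #|bd A| M); rewrite leq_mul2l /=.
by apply: leq_sum => m _; apply: thick_columns x0_empty y0_empty _.
Qed.

(** The complement of [A :|: bd A] avoids the same row and column, and its boundary lies in [bd A],
    so [card_avoiding] bounds it. *)
Lemma card_containing A x0 y0 :
  (forall y, (x0, y) \in A) -> (forall x, (x, y0) \in A) ->
  2 * (M * N) <= 2 * #|A| + #|bd A| * #|bd A|.+1.
Proof.
move=> x0_full y0_full; set D := ~: (A :|: bd A).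
have D_bd : #|bd D| <= #|bd A|.
  apply/subset_leq_card/subsetP => w /vbdP[]; rewrite inE negbK in_setU.
  case/orP => // wA [v]; rewrite inE in_setU negb_or => /andP[vA /negP vB] avw; case: vB.
  by apply/vbdP; split=> //; exists w => //; rewrite grid2_sym.
have x0_D y : (x0, y) \notin D by rewrite inE negbK in_setU x0_full.
have y0_D x : (x, y0) \notin D by rewrite inE negbK in_setU y0_full.
have := card_avoiding x0_D y0_D.
have cU : #|A :|: bd A| = #|A| + #|bd A|.
  rewrite cardsU (_ : A :&: bd A = set0) ?cards0 ?subn0 //; apply/setP => w.
  by rewrite !inE; case: (w \in A).
have := cardsC (A :|: bd A); rewrite -/D card_prod !card_ord cU.
move: #|D| #|bd D| #|bd A| #|A| D_bd {cU} => x y z t; case: y => [|y]; nia.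
Qed.

(** A row or column meeting both [A] and its complement contains a boundary point, so fewer than [M]
    of these leave some row and some column uniform. The thresholds for [#|A|] are
    [(M - 1)(M - 2) / 2] and [M * N - M(M - 1) / 2]. *)
Lemma grid2_isoperimetry A : M <= N -> #|bd A| < M ->
  2 * #|A| + 3 * M <= M * M + 2 \/ 2 * (M * N) + M <= 2 * #|A| + M * M.
Proof.
move=> leMN bd_lt.
have [x Hx] : exists x, (forall y, (x, y) \in A) \/ (forall y, (x, y) \notin A).
  have : [exists x, [forall y, (x, y) \in A] || [forall y, (x, y) \notin A]].
    apply: contraLR bd_lt => /existsPn mixed; rewrite -leqNgt.
    apply: leq_trans (leq_imset_card fst _); rewrite -[leqLHS]card_ord.
    apply/subset_leq_card/subsetP => x _.
    have := mixed x; rewrite negb_or => /andP[/forallPn[y Ay] /forallPn[y' Ay']].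
    have [u uB _] := row_exit (negPn Ay') Ay.
    by apply/imsetP; exists (x, u).
  by case/existsP => x /orP[] /forallP Hx; exists x; [left | right].
have [y Hy] : exists y, (forall x, (x, y) \in A) \/ (forall x, (x, y) \notin A).
  have : [exists y, [forall x, (x, y) \in A] || [forall x, (x, y) \notin A]].
    apply: contraLR bd_lt => /existsPn mixed; rewrite -leqNgt.
    apply: leq_trans leMN _.
    apply: leq_trans (leq_imset_card snd _); rewrite -[leqLHS]card_ord.
    apply/subset_leq_card/subsetP => y _.
    have := mixed y; rewrite negb_or => /andP[/forallPn[x1 Ax] /forallPn[x' Ax']].
    have [u uB] := col_exit (negPn Ax') Ax.
    by apply/imsetP; exists (u, y).
  by case/existsP => y /orP[] /forallP Hy; exists y; [left | right].
(* A full line and an empty one would disagree at their crossing. *)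
case: Hx Hy => Hx [] Hy; try by have := Hx y; rewrite ?Hy // (negbTE (Hy x)).
  right; have := card_containing Hx Hy; nia.
have staircase b m : b < m -> b * b.-1 + 3 * m <= m * m + 2.
  by move=> /subnKC <-; case: b (m - b.+1) => [|b] [|n]; nia.
left; have := card_avoiding Hx Hy; have := staircase _ _ bd_lt; lia.
Qed.

Lemma grid2_depth_lb S : M <= N -> is_swap_network (grid2 M N) S ->
  M - 1 <= swap_depth S.
Proof.
move=> leMN S_ok; case: (leqP M 1) => M_gt1; first by rewrite (eqP M_gt1).
(* The least size above the lower threshold of [grid2_isoperimetry]; for [M >= 2], [k.+1] is still
   below the upper one. *)
pose k := ((M - 1) * (M - 2))./2.+1.
have k2 : 2 * k + 3 * M = M * M + 4.
  rewrite /k; case: (M) M_gt1 => [|[|m]] // _; rewrite subSS subn0 !subSS subn0.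
  have : ~~ odd (m.+1 * m) by rewrite oddM /= andNb.
  nia.
have MN : M * M <= M * N by rewrite leq_mul2l leMN orbT.
have k_gt0 : 0 < k by []; move: k k2 k_gt0 => k k2 k_gt0.
suff : M <= (swap_depth S).+1 by lia.
apply: (isoperimetric_depth2 S_ok (k := k)) => //; first lia.
  by rewrite card_prod !card_ord; nia.
move=> A k_rng; rewrite leqNgt; apply/negP => /(grid2_isoperimetry leMN).
by move: k_rng; set a := #|A| => k_rng []; lia.
Qed.

End Grid2.

(** * Vertex isoperimetry in the spin grid *)

Section Grid3.
Variables (M N : nat).

Definition spin_slice (A : {set 'I_2 * 'I_M * 'I_N}) (s : 'I_2) :=
  [set v : 'I_M * 'I_N | (s, v.1, v.2) \in A].

Lemma mem_spin_slice A s x y : ((x, y) \in spin_slice A s) = ((s, x, y) \in A).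
Proof. by rewrite inE. Qed.

Lemma card_spin_slices (A : {set 'I_2 * 'I_M * 'I_N}) :
  #|A| = \sum_s #|spin_slice A s|.
Proof.
pose f (u : 'I_2 * ('I_M * 'I_N)) := (u.1, u.2.1, u.2.2).
rewrite -sum1_card (reindex f) /=; last first.
  by exists (fun u => (u.1.1, (u.1.2, u.2))) => [[s [x y]]|[[s x] y]].
rewrite (eq_bigr (fun s => \sum_(v in spin_slice A s) 1)); last first.
  by move=> s _; rewrite sum1_card.
by rewrite pair_big_dep /=; apply: eq_bigl => u; rewrite inE.
Qed.

(** Boundary points of a slice arise from grid edges inside it, or from spin edges to points of [A]
    in the other slice. *)
Lemma spin_slice_vbd (A : {set 'I_2 * 'I_M * 'I_N}) s s' : s != s' ->
  vbd (grid2 M N) (spin_slice A s) :|: (spin_slice A s' :\: spin_slice A s)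
    \subset spin_slice (vbd (grid3 M N) A) s.
Proof.
move=> ss'; apply/subsetP => -[x y]; rewrite in_setU (mem_spin_slice (vbd _ _)).
case/orP=> [/vbdP[]|].
  rewrite mem_spin_slice => wA [[x' y']]; rewrite mem_spin_slice /grid2 /= => vA E.
  apply/vbdP; split=> //; exists (s, x', y') => //.
  by rewrite /grid3 /= eqxx /=; case/orP: E => /andP[-> ->] //; rewrite ?orbT.
rewrite in_setD !mem_spin_slice => /andP[wA vA].
apply/vbdP; split=> //; exists (s', x, y) => //.
rewrite /grid3 /= !eqxx !andbT; apply/orP; left.
by case: s s' ss' {wA vA} => [[|[|[]//]] ?] [[|[|[]//]] ?].
Qed.

(** Here [#|A|] is [(M - 1)^2 + 1]. With fewer than [2 * M] boundary points, one slice of the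
    boundary has fewer than [M], so that slice of [A] is very small or very large. The other slice
    is then larger by at least [M], respectively smaller by at least [3 * M - 2], and this
    difference exceeds the boundary in the smaller slice. *)
Lemma grid3_isoperimetry (A : {set 'I_2 * 'I_M * 'I_N}) :
  2 <= M -> M <= N -> #|A| + 2 * M = M * M + 2 ->
  2 * M <= #|vbd (grid3 M N) A|.
Proof.
move=> M_ge2 leMN A_card; rewrite leqNgt; apply/negP => bd_lt.
have := card_spin_slices A; have := card_spin_slices (vbd (grid3 M N) A).
rewrite !big_ord_recl !big_ord0 !addn0 /=.
set s0 := ord0; set s1 := lift _ _ => bd_sum A_sum.
have low s s' : s != s' ->
    #|vbd (grid2 M N) (spin_slice A s)| <= #|spin_slice (vbd (grid3 M N) A) s| /\
    #|spin_slice A s'| - #|spin_slice A s| <= #|spin_slice (vbd (grid3 M N) A) s|.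
  move=> /(spin_slice_vbd A); rewrite subUset => /andP[/subset_leq_card h].
  move/subset_leq_card; rewrite cardsD => h'; split=> //; apply: leq_trans h'.
  by apply: leq_sub2l; apply/subset_leq_card/subsetIr.
have [l0 l0'] := low s0 s1 isT; have [l1 l1'] := low s1 s0 isT.
have i0 := @grid2_isoperimetry M N (spin_slice A s0) leMN.
have i1 := @grid2_isoperimetry M N (spin_slice A s1) leMN.
have MN : M * M <= M * N by rewrite leq_mul2l leMN orbT.
set n := #|A| in A_card A_sum.
set a0 := #|spin_slice A s0| in A_sum l0' l1' i0.
set a1 := #|spin_slice A s1| in A_sum l0' l1' i1.
set b0 := #|vbd _ (spin_slice A s0)| in l0 i0.
set b1 := #|vbd _ (spin_slice A s1)| in l1 i1.
set b := #|vbd _ A| in bd_lt bd_sum.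
set c0 := #|spin_slice _ s0| in bd_sum l0 l0'.
set c1 := #|spin_slice _ s1| in bd_sum l1 l1'.
lia.
Qed.

(** Since [2 * M] is even, the general bound already gives [M <= uphalf (swap_depth S)], without the
    refinement for odd depth. *)
Lemma grid3_depth_lb S : 2 <= M -> M <= N -> is_swap_network (grid3 M N) S ->
  2 * M - 1 <= swap_depth S.
Proof.
move=> M_ge2 leMN S_ok.
have : 2 * M <= 2 * uphalf (swap_depth S) + 1.
  apply: (isoperimetric_depth S_ok (k := M * M + 2 - 2 * M)); first lia.
    by rewrite !card_prod !card_ord; nia.
  by move=> A A_card; apply: grid3_isoperimetry => //; rewrite A_card; nia.
lia.
Qed.

End Grid3.

(** * Optimal networks for grids *)

(** Parallel edges keep one coordinate and shift the other by one, so either endpoint determines the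
    other. *)
Ltac match2 :=
  move=> [? ?] [? ?] [? ?] /and3P[_ /= /eqP-> /eqP+] /and3P[_ /= /eqP-> /eqP+];
  move=> ? ?; congr pair; apply: val_inj => /=; lia.

Section GridNet2.
Variables (M N : nat).
Local Notation V := ('I_M * 'I_N)%type.

(* Columns are concatenated; in this order [2 * i] and [2 * i + 1] always have
   opposite colours and both receive rank [i]. *)
Definition cell2 (v : V) : nat := v.2 * M + v.1.
Definition black2 (v : V) : bool := ~~ odd (v.1 + v.2).
Definition rank2 (v : V) : nat := (cell2 v)./2.

Lemma cell2_lt v : cell2 v < M * N.
Proof. by case: v => x y; have := (ltn_ord x, ltn_ord y) => -[]; rewrite /cell2 /=; nia. Qed.

Lemma cell2_inj (v w : V) : cell2 v = cell2 w -> v = w.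
Proof.
case: v w => [x y] [x' y']; rewrite /cell2 /= => E.
have M_gt0 : 0 < M by case: x {E} => x; case: (M).
have Ey : y = y' :> nat.
  by have := congr1 (divn^~ M) E; rewrite !divnMDl // !divn_small // !addn0.
by congr pair; apply: val_inj => //=; move: E; rewrite Ey; lia.
Qed.

Lemma odd_cell2 v : odd M -> odd (cell2 v) = ~~ black2 v.
Proof. by move=> M_odd; rewrite /cell2 /black2 oddD oddM M_odd andbT negbK oddD addbC. Qed.

(** Distinct vertices of equal rank have consecutive cells, the first even. For odd [M] colours
    alternate along the list; for even [M] such a pair never straddles two columns. *)
Lemma rank2_inj v w : black2 v = black2 w -> rank2 v = rank2 w -> v = w.
Proof.
wlog le_vw : v w / cell2 v <= cell2 w => [hw B E | B E].
  by case: (leqP (cell2 v) (cell2 w)) => [|/ltnW] le; [|symmetry]; apply: hw.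
apply: cell2_inj; apply/eqP; rewrite eqn_leq le_vw leqNgt; apply/negP => lt_vw.
rewrite /rank2 in E; have Ec : cell2 w = (cell2 v).+1 by lia.
case: (boolP (odd M)) => M_odd.
  have := odd_cell2 v M_odd; have := odd_cell2 w M_odd; rewrite B; lia.
have v_even : ~~ odd v.1.
  have : ~~ odd (cell2 v) by lia.
  by rewrite /cell2 oddD oddM (negbTE M_odd) andbF.
have lt_M : v.1.+1 < M by have := ltn_ord v.1; lia.
have Ew : w = (Ordinal lt_M, v.2) by apply: cell2_inj; rewrite Ec /cell2 /= addnS.
by move: B; rewrite Ew /black2 /=; lia.
Qed.

Lemma rank2_lt v : rank2 v < if black2 v then uphalf (M * N) else (M * N)./2.
Proof.
have v_lt := cell2_lt v; rewrite /rank2; case: (boolP (odd M)) => M_odd.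
  by have := odd_cell2 v M_odd; case: (black2 v); lia.
have : ~~ odd (M * N) by rewrite oddM (negbTE M_odd).
by case: (black2 v); lia.
Qed.

Lemma grid2_black v w : grid2 M N v w -> black2 v = ~~ black2 w.
Proof.
rewrite /grid2 /black2 /near.
by move=> /orP[/andP[/eqP-> n]|/andP[n /eqP->]]; lia.
Qed.

Definition left2 : rel V := fun v w =>
  [&& black2 v, v.1 == w.1 & w.2.+1 == v.2].
Definition right2 : rel V := fun v w =>
  [&& black2 v, v.1 == w.1 & v.2.+1 == w.2].
Definition down2 : rel V := fun v w =>
  [&& black2 v, v.2 == w.2 & w.1.+1 == v.1].
Definition up2 : rel V := fun v w =>
  [&& black2 v, v.2 == w.2 & v.1.+1 == w.1].
Definition rung2 : rel V := fun v w =>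
  [&& black2 v, v.2 == w.2 & near v.1 w.1].

(** With offset [M.-1./2], the left neighbour of a black vertex is the first white vertex of its
    window and the right neighbour the last; vertical neighbours differ in rank by at most one and
    are met midway. *)
Local Notation layer2 :=
  (layer_at black2 rank2 (uphalf (M * N)) (M * N)./2 M.-1./2 (grid2 M N)).

Lemma layer2P t (r : rel V) :
  (forall v w, r v w -> [/\ grid2 M N v w, black2 v &
     rank2 w + M.-1./2 = rank2 v + t \/ rank2 w + M.-1./2 + 1 = rank2 v + t]) ->
  (forall v w w', r v w -> r v w' -> w = w') ->
  (forall v v' w, r v w -> r v' w -> v = v') ->
  layer2 t r.
Proof.
move=> r_ok; apply: (bipartite_layer_at rank2_lt) => v w /r_ok[A B E].
by split=> //; rewrite -(grid2_black A).
Qed.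

Lemma left2_layer : layer2 0 left2.
Proof.
apply: layer2P; [|match2|match2] => v w R.
have A : grid2 M N v w by move: R; rewrite /left2 /grid2 /near; lia.
have := grid2_black A; case/and3P: R => B /eqP E1 /eqP E2; rewrite B => Bw.
have Ec : cell2 v = cell2 w + M by rewrite /cell2 -E1 -E2; nia.
by split=> //; have := odd_cell2 w; rewrite -Bw /rank2 Ec; lia.
Qed.

Lemma right2_layer : layer2 (M - 1) right2.
Proof.
apply: layer2P; [|match2|match2] => v w R.
have A : grid2 M N v w by move: R; rewrite /right2 /grid2 /near; lia.
have := grid2_black A; case/and3P: R => B /eqP E1 /eqP E2; rewrite B => Bw.
have Ec : cell2 w = cell2 v + M by rewrite /cell2 -E1 -E2; nia.
have M_gt0 := leq_ltn_trans (leq0n _) (ltn_ord v.1).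
by split=> //; have := odd_cell2 v; rewrite B /rank2 Ec; lia.
Qed.

Lemma down2_layer : layer2 M.-1./2 down2.
Proof.
apply: layer2P; [|match2|match2] => v w R.
have A : grid2 M N v w by move: R; rewrite /down2 /grid2 /near; lia.
case/and3P: R => B /eqP E1 /eqP E2; split=> //.
have Ec : cell2 v = (cell2 w).+1 by rewrite /cell2 -E1 -E2; lia.
by rewrite /rank2 Ec; lia.
Qed.

Lemma up2_layer : layer2 M.-1./2.+1 up2.
Proof.
apply: layer2P; [|match2|match2] => v w R.
have A : grid2 M N v w by move: R; rewrite /up2 /grid2 /near; lia.
case/and3P: R => B /eqP E1 /eqP E2; split=> //.
have Ec : cell2 w = (cell2 v).+1 by rewrite /cell2 -E1 -E2; lia.
by rewrite /rank2 Ec; lia.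
Qed.

(** For [M = 2] both ends of a rung have the same rank, so up and down edges share one layer. *)
Lemma rung2_layer : M = 2 -> layer2 0 rung2.
Proof.
move=> M2; apply: layer2P => v w.
- move=> R; have A : grid2 M N v w by move: R; rewrite /rung2 /grid2 /near; lia.
  case/and3P: R => B /eqP E1 E2; split=> //.
  have [? ?] := (ltn_ord v.1, ltn_ord w.1).
  by move: E2; rewrite /near /rank2 /cell2 -E1; lia.
- case: v w => [x y] [x1 y1] [x2 y2] /and3P[_ /= /eqP E1 n1] /and3P[_ /= /eqP E2 n2].
  congr pair; last by rewrite -E1.
  apply: val_inj => /=; have := (ltn_ord x1, ltn_ord x2) => -[].
  by move: n1 n2; rewrite /near; lia.
- case: v w => [x y] [x1 y1] [x2 y2] /and3P[_ /= /eqP E1 n1] /and3P[_ /= /eqP E2 n2].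
  congr pair; last by rewrite E1.
  apply: val_inj => /=; have := (ltn_ord x, ltn_ord x1) => -[].
  by move: n1 n2; rewrite /near; lia.
Qed.

Lemma grid2_cover v w : grid2 M N v w -> black2 v ->
  [|| left2 v w, right2 v w, down2 v w | up2 v w].
Proof. by rewrite /grid2 /near /left2 /right2 /down2 /up2 => A ->; lia. Qed.

Definition net2 d rs : swap_net V :=
  brick_net black2 rank2 (uphalf (M * N)) (M * N)./2 M.-1./2 d rs.

Lemma net2P d rs :
  (forall n, n < size rs -> let tr := nth (0, fun _ _ => false) rs n in
     tr.1 <= d /\ layer2 tr.1 tr.2) ->
  (forall v w, grid2 M N v w -> black2 v -> has (fun tr => tr.2 v w) rs) ->
  is_swap_network (grid2 M N) (net2 d rs).
Proof.
move=> rs_ok cov.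
have cov' v w : grid2 M N v w -> black2 v -> exists n, n < size rs /\
    (nth (0, fun _ _ => false) rs n).2 v w.
  move=> A B; exists (find (fun tr => tr.2 v w) rs).
  by split; [rewrite -has_find cov | apply: nth_find (cov _ _ A B)].
apply: (brick_netP rank2_inj rank2_lt) => //.
  by rewrite card_prod !card_ord; lia.
move=> v w A; case: (boolP (black2 v)) => Bv.
  by have [n [n_lt H]] := cov' _ _ A Bv; exists n; split=> //; left.
have Bw : black2 w by rewrite -[black2 w]negbK -(grid2_black A).
rewrite grid2_sym in A.
by have [n [n_lt H]] := cov' _ _ A Bw; exists n; split=> //; right.
Qed.

End GridNet2.

Arguments net2 M N d rs : clear implicits.

(** The neighbours [s] of [v] certify minimality through [degree_le_interaction_depth]. *)
Definition degree_optimal (V : finType) (adj : rel V) d : Prop :=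
  exists S v s, [/\ is_swap_network adj S, swap_depth S = d, uniq s,
    forall w, w \in s -> adj v w & interaction_depth S = size s].

Lemma grid2_net_M3 M N : 3 <= M -> M <= N -> degree_optimal (grid2 M N) (M - 1).
Proof.
move=> M_ge3 leMN.
pose rs : seq (nat * rel ('I_M * 'I_N)) :=
  [:: (0, @left2 M N); (M - 1, @right2 M N);
      (M.-1./2, @down2 M N); (M.-1./2.+1, @up2 M N)].
have N_ge3 := leq_trans M_ge3 leMN.
have [h0 h1 h2] : [/\ 0 < M, 1 < M & 2 < M] by split; lia.
have [k0 k1 k2] : [/\ 0 < N, 1 < N & 2 < N] by split; lia.
exists (net2 M N (M - 1) rs), (Ordinal h1, Ordinal k1),
  [:: (Ordinal h0, Ordinal k1); (Ordinal h2, Ordinal k1);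
      (Ordinal h1, Ordinal k0); (Ordinal h1, Ordinal k2)].
split=> //.
- apply: net2P => [|v w A B].
    case=> [|[|[|[|//]]]] _; split=> /=; try lia.
    - exact: left2_layer.
    - exact: right2_layer.
    - exact: down2_layer.
    - exact: up2_layer.
  by rewrite /= orbF; exact: grid2_cover.
- by rewrite /swap_depth size_mkseq.
- by move=> w; rewrite !inE => /or4P[] /eqP->.
Qed.

Lemma grid2_net_M2 N : 3 <= N -> degree_optimal (grid2 2 N) 1.
Proof.
move=> N_ge3.
pose rs : seq (nat * rel ('I_2 * 'I_N)) :=
  [:: (0, @left2 2 N); (1, @right2 2 N); (0, @rung2 2 N)].
have [k0 k1] : 0 < N /\ 1 < N by split; lia.
exists (net2 2 N 1 rs), (ord0, Ordinal k1),
  [:: (ord_max, Ordinal k1); (ord0, Ordinal k0); (ord0, Ordinal N_ge3)].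
split=> //.
- apply: net2P => [|v w A B].
    case; first by split=> //; exact: left2_layer.
    case; first by split=> //; exact: right2_layer.
    by case=> // _; split=> //; exact: rung2_layer.
  have := grid2_cover A B; rewrite /= /rung2 /down2 /up2 /near.
  by case: (left2 v w); case: (right2 v w) => //=; lia.
- by move=> w; rewrite !inE => /or3P[] /eqP->.
Qed.

Lemma grid2_net_M1 N : 1 <= N -> degree_optimal (grid2 1 N) 0.
Proof.
move=> N_ge1; have v0 : ('I_1 * 'I_N)%type by exact: (ord0, Ordinal N_ge1).
have noV (v w : 'I_1 * 'I_N) : near v.1 w.1 = false by rewrite !ord1.
case: N N_ge1 v0 noV => [|[|[|N]]] // _ v0 noV.
- exists (net2 1 1 0 [::]), v0, [::]; split=> //; apply: net2P => // v w.
  by rewrite /grid2 noV !ord1.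
- exists (net2 1 2 0 [:: (0, @right2 1 2)]), (ord0, ord0), [:: (ord0, ord_max)].
  split=> //; last by move=> w; rewrite !inE => /eqP->.
  apply: net2P => [[|n] // _ | v w A B]; first by split=> //; exact: right2_layer.
  (* The only black vertex is the left end, so [right2] alone covers the edge. *)
  have v2_0 : v.2 = 0 :> nat.
    by move: B; rewrite /black2 (ord1 v.1) /=; have := ltn_ord v.2; lia.
  have := grid2_cover A B; have := noV v w; rewrite /= /left2 /down2 /up2 /near v2_0.
  by case: (right2 v w) => //=; lia.
- pose rs : seq (nat * rel ('I_1 * 'I_N.+3)) := [:: (0, @left2 1 _); (0, @right2 1 _)].
  exists (net2 1 N.+3 0 rs), (ord0, inord 1), [:: (ord0, inord 0); (ord0, inord 2)].
  split=> //.
  + apply: net2P => [|v w A B].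
      case; first by split=> //; exact: left2_layer.
      by case=> // _; split=> //; exact: right2_layer.
    have := grid2_cover A B; have := noV v w; rewrite /= /down2 /up2 /near.
    by case: (left2 v w); case: (right2 v w) => //=; lia.
  + by rewrite /= inE andbT xpair_eqE eqxx -val_eqE /= !inordK.
  + by move=> w; rewrite !inE => /orP[] /eqP->; rewrite /grid2 /near /= !inordK.
Qed.

(* The 4-cycle needs its own network: both matchings are perfect, and the first
   row moves right while the second moves left. *)
Lemma grid2_net_M2N2 : degree_optimal (grid2 2 2) 1.
Proof.
pose V := ('I_2 * 'I_2)%type.
pose blk (v : V) := (v.1 : nat) == 0; pose rk (v : V) : nat := v.2.
(* The leading [true] gives [rh] and [rv] the three-conjunct shape that [match2] destructs. *)
pose rh : rel V := fun v w => [&& true, v.1 == w.1 & v.2.+1 == w.2].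
pose rv : rel V := fun v w => [&& true, v.2 == w.2 & v.1.+1 == w.1].
exists (brick_net blk rk 2 2 1 1 [:: (0, rh); (1, rv)]), (ord0, ord0),
  [:: (ord0, ord_max); (ord_max, ord0)].
split=> //; last by move=> w; rewrite !inE => /orP[] /eqP->.
apply: brick_netP.
- move=> [x y] [x' y']; rewrite /blk /rk /= => E1 E2.
  have [? ?] := (ltn_ord x, ltn_ord x').
  by congr pair; apply: val_inj => /=; lia.
- by move=> v; rewrite /rk if_same.
- by rewrite card_prod !card_ord.
- case; [|case=> //] => _; split=> //=; split.
  + move=> [x y] [x' y'] /and3P[_ /= /eqP-> /eqP E].
    split; first by rewrite /grid2 /near /= eqxx E eqxx.
    by rewrite /brick_pos /blk /rk /=; have := ltn_ord y'; case: (_ == 0); lia.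
  (* Horizontal edges join vertices of equal [blk], so the column separates their ends instead. *)
  + apply (@matching_disjoint _ (fun v : V => (v.2 : nat) == 0) rh); try match2.
    by move=> [x y] [x' y'] /and3P[_ _ /= /eqP E]; have := ltn_ord y'; lia.
  + move=> [x y] [x' y'] /and3P[_ /= /eqP-> /eqP E].
    split; first by rewrite /grid2 /near /= eqxx E eqxx orbT.
    rewrite /brick_pos /blk /rk /=; have := (ltn_ord x', ltn_ord y') => -[].
    by case: ifP; case: ifP; lia.
  + apply (@matching_disjoint _ (fun v : V => (v.1 : nat) == 0) rv); try match2.
    by move=> [x y] [x' y'] /and3P[_ _ /= /eqP E]; have := ltn_ord x'; lia.
- move=> [x y] [x' y']; rewrite /grid2 /near /= => /orP[]/andP[].
    by move=> /eqP-> n; exists 0; split=> //=; rewrite /rh /= eqxx; exact/orP.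
  by move=> n /eqP->; exists 1; split=> //=; rewrite /rv /= eqxx; exact/orP.
Qed.

(** * Networks for the spin grid *)

Section GridNet3.
Variables (M N : nat).
Local Notation V := ('I_2 * 'I_M * 'I_N)%type.

Definition black3 (v : V) : bool := ~~ odd (v.1.1 + v.1.2 + v.2).
(** The two spins of a site share a rank and have opposite colours. *)
Definition rank3 (v : V) : nat := v.2 * M + v.1.2.

Lemma rank3_inj v w : black3 v = black3 w -> rank3 v = rank3 w -> v = w.
Proof.
case: v w => [[s x] y] [[s' x'] y'] B E.
have [Ex Ey] : x = x' /\ y = y'.
  by have [] := @cell2_inj M N (x, y) (x', y') E.
move: B; rewrite Ex Ey /black3 /= => B; congr (_, _, _); apply: val_inj => /=.
by have [? ?] := (ltn_ord s, ltn_ord s'); lia.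
Qed.

Lemma rank3_lt v : rank3 v < if black3 v then M * N else M * N.
Proof. by rewrite if_same; exact: (@cell2_lt M N (v.1.2, v.2)). Qed.

Lemma grid3_sym v w : grid3 M N v w = grid3 M N w v.
Proof.
rewrite /grid3 (nearC w.1.1) (nearC w.1.2) (nearC w.2).
by rewrite (eq_sym w.1.1) (eq_sym w.1.2) (eq_sym w.2).
Qed.

Lemma grid3_black v w : grid3 M N v w -> black3 v = ~~ black3 w.
Proof.
rewrite /grid3 /black3 /near => /or3P[] /andP[/andP[]].
- by move=> n /eqP-> /eqP->; lia.
- by move=> /eqP-> n /eqP->; lia.
- by move=> /eqP-> /eqP-> n; lia.
Qed.

Definition left3 : rel V := fun v w =>
  [&& black3 v, v.1 == w.1 & w.2.+1 == v.2].
Definition right3 : rel V := fun v w =>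
  [&& black3 v, v.1 == w.1 & v.2.+1 == w.2].
Definition down3 : rel V := fun v w =>
  [&& black3 v, (v.1.1, v.2) == (w.1.1, w.2) & w.1.2.+1 == v.1.2].
Definition up3 : rel V := fun v w =>
  [&& black3 v, (v.1.1, v.2) == (w.1.1, w.2) & v.1.2.+1 == w.1.2].
Definition spin3 : rel V := fun v w =>
  [&& black3 v, (v.1.2, v.2) == (w.1.2, w.2) & near v.1.1 w.1.1].

(** With offset [M.-1], the window of a black vertex of rank [r] runs from [r - M] at time [0] to
    [r + M] at time [2 * M - 1], the ranks of its left and right neighbours. *)
Local Notation layer3 :=
  (layer_at black3 rank3 (M * N) (M * N) M.-1 (grid3 M N)).

Lemma layer3P t (r : rel V) :
  (forall v w, r v w -> [/\ grid3 M N v w, black3 v &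
     rank3 w + M.-1 = rank3 v + t \/ rank3 w + M.-1 + 1 = rank3 v + t]) ->
  (forall v w w', r v w -> r v w' -> w = w') ->
  (forall v v' w, r v w -> r v' w -> v = v') ->
  layer3 t r.
Proof.
move=> r_ok; apply: (bipartite_layer_at rank3_lt) => v w /r_ok[A B E].
by split=> //; rewrite -(grid3_black A).
Qed.

Ltac match3 :=
  move=> [[? ?] ?] [[? ?] ?] [[? ?] ?]
    /and3P[_ /= /eqP[-> ->] /eqP+] /and3P[_ /= /eqP[-> ->] /eqP+];
  move=> ? ?; congr (_, _, _); apply: val_inj => /=; lia.

Lemma left3_layer : layer3 0 left3.
Proof.
apply: layer3P; [|match3|match3] => -[[s x] y] [[s' x'] y'].
case/and3P=> B /= /eqP[<- <-] /eqP E; have M_gt0 := leq_ltn_trans (leq0n _) (ltn_ord x).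
split=> //; first by rewrite /grid3 /near /= !eqxx; lia.
by rewrite /rank3 /= -E; lia.
Qed.

Lemma right3_layer : layer3 (2 * M - 1) right3.
Proof.
apply: layer3P; [|match3|match3] => -[[s x] y] [[s' x'] y'].
case/and3P=> B /= /eqP[<- <-] /eqP E; have M_gt0 := leq_ltn_trans (leq0n _) (ltn_ord x).
split=> //; first by rewrite /grid3 /near /= !eqxx; lia.
by rewrite /rank3 /= -E; lia.
Qed.

Lemma down3_layer : layer3 M.-1 down3.
Proof.
apply: layer3P; [|match3|match3] => -[[s x] y] [[s' x'] y'].
case/and3P=> B /= /eqP[<- <-] /eqP E; split=> //; last by rewrite /rank3 /= -E; lia.
by rewrite /grid3 /near /= !eqxx; lia.
Qed.

Lemma up3_layer : layer3 M up3.
Proof.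
apply: layer3P; [|match3|match3] => -[[s x] y] [[s' x'] y'].
case/and3P=> B /= /eqP[<- <-] /eqP E; have M_gt0 := leq_ltn_trans (leq0n _) (ltn_ord x).
split=> //; last by rewrite /rank3 /= -E; lia.
by rewrite /grid3 /near /= !eqxx; lia.
Qed.

Lemma spin3_layer : layer3 M.-1 spin3.
Proof.
apply: layer3P => -[[s x] y] [[s1 x1] y1].
- case/and3P=> B /= /eqP[<- <-] n; split=> //; last by rewrite /rank3 /=; lia.
  by rewrite /grid3 /= n !eqxx.
- move=> [[s2 x2] y2] /and3P[_ /= /eqP[-> ->] n1] /and3P[_ /= /eqP[-> ->] n2].
  congr (_, _, _); apply: val_inj => /=; have [? ?] := (ltn_ord s1, ltn_ord s2).
  by move: n1 n2; rewrite /near; lia.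
- move=> [[s2 x2] y2] /and3P[_ /= /eqP[-> ->] n1] /and3P[_ /= /eqP[-> ->] n2].
  congr (_, _, _); apply: val_inj => /=; have [? ?] := (ltn_ord s, ltn_ord s1).
  by move: n1 n2; rewrite /near; lia.
Qed.

Lemma grid3_cover v w : grid3 M N v w -> black3 v ->
  [|| left3 v w, right3 v w, down3 v w, up3 v w | spin3 v w].
Proof.
case: v w => [[s x] y] [[s' x'] y'].
rewrite /grid3 /left3 /right3 /down3 /up3 /spin3 !xpair_eqE /= /near => A ->.
lia.
Qed.

Lemma grid3_net : 1 <= M -> exists S, [/\ is_swap_network (grid3 M N) S,
  swap_depth S = 2 * M - 1 & interaction_depth S = 6].
Proof.
(* Five directions take one layer each; the empty layer brings the count to six. *)
move=> M_gt0; pose rs : seq (nat * rel V) :=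
  [:: (0, left3); (2 * M - 1, right3); (M.-1, down3); (M, up3);
      (M.-1, spin3); (0, fun _ _ => false)].
exists (brick_net black3 rank3 (M * N) (M * N) M.-1 (2 * M - 1) rs).
split=> //; last by rewrite /swap_depth size_mkseq.
have cov v w : grid3 M N v w -> black3 v -> exists n, n < size rs /\
    (nth (0, fun _ _ => false) rs n).2 v w.
  move=> A /(grid3_cover A) H; exists (find (fun tr => tr.2 v w) rs).
  have has_rs : has (fun tr => tr.2 v w) rs by rewrite /= orbF.
  by split; [rewrite -has_find | apply: nth_find has_rs].
apply: (brick_netP rank3_inj rank3_lt).
- by rewrite !card_prod !card_ord; lia.
- case=> [|[|[|[|[|[|//]]]]]] _; split=> /=; try lia.
  + exact: left3_layer.
  + exact: right3_layer.
  + exact: down3_layer.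
  + exact: up3_layer.
  + exact: spin3_layer.
  + by split.
- move=> v w A; case: (boolP (black3 v)) => Bv.
    by have [n [n_lt H]] := cov _ _ A Bv; exists n; split=> //; left.
  have Bw : black3 w by rewrite -[black3 w]negbK -(grid3_black A).
  rewrite grid3_sym in A.
  by have [n [n_lt H]] := cov _ _ A Bw; exists n; split=> //; right.
Qed.

End GridNet3.

Theorem theorem1 :
  (forall M N : nat, 1 <= M -> M <= N ->
     dswap_eq (grid2 M N) (M - 1) /\
     exists S, is_swap_network (grid2 M N) S /\ swap_depth S = M - 1 /\
       (forall S', is_swap_network (grid2 M N) S' ->
          interaction_depth S <= interaction_depth S')) /\
  (forall M N : nat, 2 <= M -> M <= N ->
     dswap_eq (grid3 M N) (2 * M - 1) /\
     exists S, is_swap_network (grid3 M N) S /\ swap_depth S = 2 * M - 1 /\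
       interaction_depth S = 6).
Proof.
split=> M N M_ge leMN.
  have [S [v [s [S_ok S_d s_uniq s_adj S_i]]]] : degree_optimal (grid2 M N) (M - 1).
    case: M M_ge leMN => [|[|[|M]]] // _ leMN.
    - exact: grid2_net_M1.
    - case: N leMN => [|[|[|N]]] // _; [exact: grid2_net_M2N2 | exact: grid2_net_M2].
    - exact: grid2_net_M3.
  split.
    split; first by exists S.
    by move=> S'; exact: grid2_depth_lb.
  exists S; split=> //; split=> // S' S'_ok; rewrite S_i.
  exact: degree_le_interaction_depth S'_ok s_uniq s_adj.
have [S [S_ok S_d S_i]] := @grid3_net M N (ltnW M_ge).
split; last by exists S.
split; first by exists S.
by move=> S'; exact: grid3_depth_lb.
Qed.
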